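(* Let $X$ be a complex Hilbert space and let $$H=\begin{pmatrix} A & B\\ C & -A^*\end{pmatrix}$$ be a Hamiltonian operator matrix on $X\times X$. Suppose that $\mathcal{D}(H)=\mathcal{D}(C)\times\mathcal{D}(B)$. Then the following statements are equivalent: (1) $H$ is symplectic self-adjoint; (2) $C+\lambda+A^*(B-\lambda)^{-1}A=\bigl(C+\overline{\lambda}+A^*(B-\overline{\lambda})^{-1}A\bigr)^*$ for some (and hence for all) $\lambda\in\rho(B)$; (3) $B+\lambda+A(C-\lambda)^{-1}A^*=\bigl(B+\overline{\lambda}+A(C-\overline{\lambda})^{-1}A^*\bigr)^*$ for some (and hence for all) $\lambda\in\rho(C)$.
   Context: All operators are linear and possibly unbounded; $\mathcal{D}(T)$ denotes the domain and $\rho(T)$ the resolvent set of $T$. Sums and products of operators have their natural (maximal) domains, and equality of operators includes equality of domains. Block operator matrix: for operators $A,B,C,D$ in $X$, the matrix $H=\begin{pmatrix} A&B\\ C&D\end{pmatrix}$ denotes the operator on $X\times X$ with domain $\mathcal{D}(H)=(\mathcal{D}(A)\cap\mathcal{D}(C))\times(\mathcal{D}(B)\cap\mathcal{D}(D))$ and action $H(x_1,x_2)^t=(Ax_1+Bx_2,\;Cx_1+Dx_2)^t$. Hamiltonian operator matrix: a block operator matrix $H=\begin{pmatrix} A&B\\ C&-A^*\end{pmatrix}$ on $X\times X$, $X$ a complex Hilbert space, where $A,B,C$ are closed densely defined operators in $X$, $B$ and $C$ are self-adjoint, and $H$ is densely defined. Let $J=\begin{pmatrix}0&I\\-I&0\end{pmatrix}$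 on $X\times X$. A Hamiltonian operator matrix $H$ is called symplectic self-adjoint if $JH=(JH)^*$. *)

(* Defs.v *)
From HB Require Import structures.
From mathcomp Require Import all_boot all_order all_algebra.
From mathcomp Require Import all_classical all_reals all_analysis.
From mathcomp Require Export complex.

Set Implicit Arguments.
Unset Strict Implicit.
Unset Printing Implicit Defensive.

Import Order.TTheory GRing.Theory Num.Theory numFieldNormedType.Exports.

Local Open Scope classical_set_scope.
Local Open Scope ring_scope.

(* An unbounded operator from U to V is represented by its graph, a subset of
   U * V.  Equality of graphs is equality of operators, domains included, and
   an operator is closed when its graph is [closed] in the product topology. *)

Declare Scope op_scope.
Delimit Scope op_scope with op.

Section Operators.
Context {K : numFieldType} {U V W : lmodType K}.

Definition dom (T : set (U * V)) : set U := [set x | exists y, T (x, y)].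

Definition is_operator (T : set (U * V)) : Prop :=
  [/\ T (0, 0),
      forall (a : K) (p q : U * V), T p -> T q -> T (a *: p + q)
    & forall (x : U) (y z : V), T (x, y) -> T (x, z) -> y = z].

Definition op_scalar (a : K) : set (U * U) := [set p | p.2 = a *: p.1].

Definition op_opp (T : set (U * V)) : set (U * V) := [set p | T (p.1, - p.2)].

Definition op_add (T S : set (U * V)) : set (U * V) :=
  [set p | exists y z, [/\ T (p.1, y), S (p.1, z) & p.2 = y + z]].

(* As in [relation_scope], the right factor is applied first. *)
Definition op_comp (S : set (V * W)) (T : set (U * V)) : set (U * W) :=
  (S \; T)%relation.

(* Single-valued only when T is injective. *)
Definition op_inv (T : set (U * V)) : set (V * U) := (T ^-1)%relation.

End Operators.

Notation "a %:I" := (op_scalar a) (at level 1, format "a %:I") : op_scope.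
Notation "- T" := (op_opp T) : op_scope.
Notation "T + S" := (op_add T S) : op_scope.
Notation "T - S" := (op_add T (op_opp S)) : op_scope.
Notation "S \; T" := (op_comp S T) : op_scope.
Notation "T ^-1" := (op_inv T) : op_scope.

Section Block.
Context {K : numFieldType} {X : lmodType K}.

Definition block_op (A B C D : set (X * X)) : set ((X * X) * (X * X)) :=
  [set p | exists a b c d,
     [/\ A (p.1.1, a) /\ B (p.1.2, b),
         C (p.1.1, c) /\ D (p.1.2, d)
       & p.2 = (a + b, c + d)]].

Definition Jop : set ((X * X) * (X * X)) :=
  block_op 0%:I%op 1%:I%op (- 1%:I)%op 0%:I%op.

Lemma dom_block_op (A B C D : set (X * X)) :
  dom (block_op A B C D) = (dom A `&` dom C) `*` (dom B `&` dom D).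
Proof.
apply/seteqP; split => -[x y] /=.
  case=> _ [a [b [c [d [[/= Aa Bb] [/= Cc Dd] _]]]]].
  by split; split; [exists a | exists c | exists b | exists d].
case=> -[[a Aa] [c Cc]] [[b Bb] [d Dd]].
by exists (a + b, c + d), a, b, c, d.
Qed.

Lemma JopE (x y : X) (z : X * X) : Jop ((x, y), z) <-> z = (y, - x).
Proof.
rewrite /Jop /block_op /op_scalar /op_opp /=; split.
  case=> a [b [c [d [[/= -> ->] [/= cE ->] ->]]]].
  by rewrite !scale0r add0r addr0 scale1r -[c]opprK cE scale1r.
move=> ->; exists 0, y, (- x), 0.
by rewrite !scale0r !scale1r opprK add0r addr0.
Qed.

End Block.

(* Bounded, everywhere defined inverse of T - lambda. *)
Definition resolvent_set {K : numFieldType} {X : normedModType K}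
    (T : set (X * X)) : set K :=
  [set lambda | exists2 F : {linear X -> X}, continuous F &
     ((T - lambda%:I)^-1)%op = [set p | p.2 = F p.1]].

Section Adjoint.
Context {K : numClosedFieldType}.

(* Graph of the adjoint of T; it is single-valued exactly when T is densely
   defined.  The inner product is linear in its first argument. *)
Definition adjoint {U : lmodType K} (ip : U -> U -> K) (T : set (U * U)) :
    set (U * U) :=
  [set p | forall x y, T (x, y) -> ip y p.1 = ip x p.2].

Definition ip_prod {U : lmodType K} (ip : U -> U -> K) (u v : U * U) : K :=
  ip u.1 v.1 + ip u.2 v.2.

(* The inner product ip makes the Banach space X a Hilbert space. *)
Definition hilbert_ip {X : completeNormedModType K}
    (ip : {dot X for (@Num.conj K)}) : Prop :=
  forall x : X, ip x x = `|x| ^+ 2.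

Definition closed_densely_defined {X : normedModType K} (T : set (X * X)) :
    Prop :=
  [/\ is_operator T, closed T & dense (dom T)].

Definition hamiltonian_op {X : lmodType K} (ip : X -> X -> K)
    (A B C : set (X * X)) : set ((X * X) * (X * X)) :=
  block_op A B C (- adjoint ip A)%op.

Definition is_hamiltonian {X : normedModType K} (ip : X -> X -> K)
    (A B C : set (X * X)) : Prop :=
  [/\ closed_densely_defined A,
      closed_densely_defined B /\ B = adjoint ip B,
      closed_densely_defined C /\ C = adjoint ip C
    & dense (dom (hamiltonian_op ip A B C))].

Definition symplectic_selfadjoint {X : lmodType K} (ip : X -> X -> K)
    (H : set ((X * X) * (X * X))) : Prop :=
  (Jop \; H)%op = adjoint (ip_prod ip) (Jop \; H)%op.

End Adjoint.

(* Main.v *)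
From HB Require Import structures.
Require Import Defs.
From mathcomp Require Import all_boot all_order all_algebra.
From mathcomp Require Import all_classical all_reals all_analysis.
From mathcomp Require Import ring lra.

Set Implicit Arguments.
Unset Strict Implicit.
Unset Printing Implicit Defensive.

Import Order.TTheory GRing.Theory Num.Theory numFieldNormedType.Exports.

Local Open Scope classical_set_scope.
Local Open Scope ring_scope.

(** Multiplying by [J] turns the question into self-adjointness of
    [T = J H = ((C, - A^* ), (- A, - B))].  For [lambda] in the resolvent set of
    [B], eliminating the second component from [T + lambda] leaves the Schur
    complement [S lambda = C + lambda + A^* (B - lambda)^-1 A], and
    [S lambda = (S lambda^* )^*] is what [(T + lambda^* )^* = T + lambda] says about
    the first component.  The inclusions of [T] and of [S lambda] in the
    adjoints hold by direct computation.  The converse inclusions are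
    [saddle_to_schur] and [schur_to_saddle].

    The obstacle is that an element [y] of the domain of [(S lambda^* )^*] need
    not be in the domain of [A] beforehand, so that the eliminated component
    [- (B - lambda)^-1 A y] has no meaning.  It is replaced by the value at [y] of
    the adjoint of [F = A^* (B - lambda^* )^-1].  As the domain of [B] is contained
    in that of [A^*], [F] is everywhere defined, and its adjoint contains
    [(B - lambda)^-1 A], so it is densely defined.  By uniform boundedness the
    adjoint of [F] is then everywhere defined ([adjoint_total]).

    Two facts on a self-adjoint [B] complete the argument.  Its resolvent set is
    closed under conjugation ([resolvent_conj]), which gives a meaning to
    [S lambda^*], and it contains the imaginary unit ([resolvent_i]), so that a
    condition on all [lambda] is not vacuous.  Both follow from the orthogonal
    projection onto closed subspaces.

    The argument uses of the linear operators [A, A^*] only that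
    [ip a y = ip x a'] on the two graphs, that both domains are dense, and the
    domain inclusions.  It is hence symmetric in the pair, and the conditions on
    the resolvent set of [C] follow from those for [B]: exchanging [A] with [A^*]
    and [B] with [C] replaces [T] by [- J^-1 T J], where [J] is unitary
    ([saddle_swap]). *)

(** * The real inner product and sequences *)

Section ComplexHilbert.
Variables (R : realType) (X : completeNormedModType R[i]).
Variable ip : {dot X for (@Num.conj R[i])}.
Hypothesis ip_hilbert : hilbert_ip ip.

Lemma ipC x y : ip x y = (ip y x)^*.
Proof. by rewrite hermC expr0 mul1r. Qed.

Lemma ipDl x y z : ip (x + y) z = ip x z + ip y z.
Proof. by rewrite linearDl. Qed.

Lemma ipDr x y z : ip z (x + y) = ip z x + ip z y.
Proof. by rewrite linearDr. Qed.

Lemma ipNl x z : ip (- x) z = - ip x z.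
Proof. by rewrite linearNl. Qed.

Lemma ipNr x z : ip z (- x) = - ip z x.
Proof. by rewrite linearNr. Qed.

Lemma ipZl a x z : ip (a *: x) z = a * ip x z.
Proof. by rewrite linearZl_LR. Qed.

Lemma ipZr a x z : ip z (a *: x) = a^* * ip z x.
Proof. by rewrite linearZr_LR. Qed.

Lemma ip0l z : ip 0 z = 0.
Proof. by rewrite linear0l. Qed.

Lemma ip0r z : ip z 0 = 0.
Proof. by rewrite linear0r. Qed.

Definition ipE := (ipDl, ipDr, ipNl, ipNr, ipZl, ipZr, ip0l, ip0r).

Lemma ip_inj x y : (forall w, ip w x = ip w y) -> x = y.
Proof.
move=> xy; apply/eqP; rewrite -subr_eq0 -(dnorm_eq0 ip).
by rewrite ipDr ipNr xy subrr.
Qed.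

(** The order and the norm of the scalars are complex-valued.  The estimates are
    made in the real numbers instead, with the real part of the inner product
    and the real value of the norm. *)
Definition rip x y : R := complex.Re (ip x y).
Definition nrm (x : X) : R := complex.Re `|x|.

Lemma nrmE x : `|x| = (nrm x)%:C%C.
Proof. by rewrite /nrm RRe_real // normr_real. Qed.

Lemma nrm_ge0 x : 0 <= nrm x.
Proof. by rewrite -lecR -nrmE; exact: normr_ge0. Qed.

Lemma nrmD x y : nrm (x + y) <= nrm x + nrm y.
Proof. by rewrite -lecR rmorphD /= -!nrmE ler_normD. Qed.

Lemma nrmN x : nrm (- x) = nrm x.
Proof. by rewrite /nrm normrN. Qed.

Lemma nrmZ (a : R) x : nrm (a%:C%C *: x) = `|a| * nrm x.
Proof.
rewrite {1}/nrm normrZ normc_def /= expr0n /= addr0 sqrtr_sqr nrmE.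
by rewrite -rmorphM.
Qed.

Lemma ReD (a b : R[i]) : complex.Re (a + b) = complex.Re a + complex.Re b.
Proof. by case: a; case: b. Qed.

Lemma ReN (a : R[i]) : complex.Re (- a) = - complex.Re a.
Proof. by case: a. Qed.

Lemma ReJ (z : R[i]) : complex.Re z^* = complex.Re z.
Proof. by case: z. Qed.

Lemma ReCM (a : R) (z : R[i]) : complex.Re (a%:C%C * z) = a * complex.Re z.
Proof. by case: z => u v /=; rewrite mul0r subr0. Qed.

Lemma ripC x y : rip x y = rip y x.
Proof. by rewrite /rip ipC ReJ. Qed.

Lemma ripDl x y z : rip (x + y) z = rip x z + rip y z.
Proof. by rewrite /rip ipDl ReD. Qed.

Lemma ripNl x z : rip (- x) z = - rip x z.
Proof. by rewrite /rip ipNl ReN. Qed.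

Lemma ripZl (a : R) x z : rip (a%:C%C *: x) z = a * rip x z.
Proof. by rewrite /rip ipZl ReCM. Qed.

Lemma ripDr x y z : rip z (x + y) = rip z x + rip z y.
Proof. by rewrite !(ripC z) ripDl. Qed.

Lemma ripNr x z : rip z (- x) = - rip z x.
Proof. by rewrite !(ripC z) ripNl. Qed.

Lemma ripZr (a : R) x z : rip z (a%:C%C *: x) = a * rip z x.
Proof. by rewrite !(ripC z) ripZl. Qed.

Definition ripE := (ripDl, ripDr, ripNl, ripNr, ripZl, ripZr).

Lemma rip_nrm x : rip x x = nrm x ^+ 2.
Proof. by rewrite /rip ip_hilbert nrmE -rmorphXn. Qed.

Lemma nrm0_eq0 x : nrm x = 0 -> x = 0.
Proof. by move=> x0; apply/eqP; rewrite -normr_eq0 nrmE x0. Qed.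

Lemma rip_le x y : rip x y <= nrm x * nrm y.
Proof.
have [/nrm0_eq0 ->|x0] := eqVneq (nrm x) 0.
  by rewrite /rip ip0l mulr_ge0 ?nrm_ge0.
have [/nrm0_eq0 ->|y0] := eqVneq (nrm y) 0.
  by rewrite /rip ip0r mulr_ge0 ?nrm_ge0.
have xp : 0 < nrm x by rewrite lt_def x0 nrm_ge0.
have yp : 0 < nrm y by rewrite lt_def y0 nrm_ge0.
have : 0 <= nrm ((nrm y)%:C%C *: x - (nrm x)%:C%C *: y) ^+ 2 by exact: sqr_ge0.
rewrite -rip_nrm !ripE (ripC y x) !rip_nrm => h.
by rewrite -subr_ge0 -(pmulr_rge0 _ xp) -(pmulr_rge0 _ yp); nra.
Qed.

(** Testing [q] against ['i *: u] gives the imaginary part of [ip u q]. *)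
Lemma rip0_ip0 (M : set X) q :
  (forall a u, M u -> M (a *: u)) ->
  (forall u, M u -> rip u q = 0) -> forall u, M u -> ip u q = 0.
Proof.
move=> MZ Mq u Mu; have := Mq _ (MZ 'i%C _ Mu); have := Mq _ Mu.
rewrite /rip ipZl; case: (ip u q) => a b /= -> /eqP.
by rewrite mul0r mul1r sub0r oppr_eq0 => /eqP ->.
Qed.

Definition tends (u : nat -> X) l :=
  forall e : R, 0 < e -> exists N, forall n, (N <= n)%N -> nrm (l - u n) < e.

Lemma cauchy_tends (u : nat -> X) :
  (forall e : R, 0 < e -> exists N, forall n m, (N <= n)%N -> (N <= m)%N ->
     nrm (u n - u m) < e) ->
  exists l, tends u l.
Proof.
move=> cu; have eC (e : R[i]) : 0 < e -> exists2 r, 0 < r & e = r%:C%C.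
  case: e => a b; rewrite ltcE /= => /andP[/eqP -> a0].
  by exists a.
have : cvg (u @ \oo).
  apply: cauchy_cvg; apply: cauchy_exP => e /eC[r r0 ->].
  have [N hN] := cu r r0; exists (u N), N => // n /= Nn.
  by rewrite -ball_normE /ball_ /= nrmE ltcR hN.
case/cvg_ex => l /cvgrPdist_lt ul; exists l => e e0.
have [|N _ hN] := ul e%:C%C; first by rewrite ltcR.
by exists N => n /hN /=; rewrite nrmE ltcR.
Qed.

Lemma dense_nrm (D : set X) : dense D ->
  forall y (e : R), 0 < e -> exists2 v, D v & nrm (y - v) < e.
Proof.
move=> Dd y e e0.
have [v [yv Dv]] : ball y e%:C%C `&` D !=set0.
  apply: Dd; last exact: ball_open.
  by exists y; apply: ballxx; rewrite ltcR.
by exists v => //; move: yv; rewrite -ball_normE /ball_ /= nrmE ltcR.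
Qed.

Lemma inv_small (e : R) : 0 < e -> exists N, forall n, (N <= n)%N ->
  n.+1%:R^-1 < e.
Proof.
move=> e0; have [N hN] : exists N : nat, e^-1 < N%:R.
  exists (Num.truncn e^-1).+1; exact: truncnS_gt.
exists N => n Nn; rewrite invf_plt ?posrE ?ltr0n //.
by apply: lt_trans hN _; rewrite ltr_nat.
Qed.

Lemma dense_tends (D : set X) : dense D ->
  forall y, exists2 v, forall n, D (v n) & tends v y.
Proof.
move=> Dd y.
have /choice[v hv] : forall n : nat, exists v, D v /\ nrm (y - v) < n.+1%:R^-1.
  move=> n; have [|v Dv yv] := dense_nrm Dd y (e := n.+1%:R^-1).
    by rewrite invr_gt0 ltr0n.
  by exists v.
exists v => [n|e /inv_small[N hN]]; first by have [] := hv n.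
by exists N => n /hN; apply: lt_trans; have [] := hv n.
Qed.

(** * Orthogonal projection *)

(** The points of [M] that almost minimise the distance to [p] form a Cauchy
    sequence by the parallelogram law.  At its limit [l] the first variation of
    the squared distance vanishes, which is orthogonality of [p - l] to [M]. *)
Lemma projection (M : set X) p :
  M 0 -> (forall a u v, M u -> M v -> M (a *: u + v)) ->
  (forall u l, (forall n, M (u n)) -> tends u l -> M l) ->
  exists2 m, M m & forall u, M u -> ip u (p - m) = 0.
Proof.
move=> M0 ML Mclosed.
have MZ a u : M u -> M (a *: u) by move=> /(ML a u 0)/(_ M0); rewrite addr0.
pose E := [set d : R | exists2 u, M u & d = nrm (p - u) ^+ 2].
have infE : has_inf E.
  split; first by exists (nrm (p - 0) ^+ 2), 0.
  by exists 0 => _ [u _ ->]; apply: sqr_ge0.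
have Ele u : M u -> inf E <= nrm (p - u) ^+ 2.
  by move=> Mu; apply: ge_inf; [case: infE | exists u].
have /choice[u hu] : forall n : nat, exists v,
    M v /\ nrm (p - v) ^+ 2 < inf E + n.+1%:R^-1.
  move=> n; have [|_ [v Mv ->] h] := @inf_adherent _ E n.+1%:R^-1 _ infE.
    by rewrite invr_gt0 ltr0n.
  by exists v.
have [l ul] : exists l, tends u l.
  apply: cauchy_tends => e e0.
  have [|N hN] := @inv_small (e ^+ 2 / 4); first by rewrite divr_gt0 ?exprn_gt0.
  exists N => n m /hN hn /hN hm.
  have [Mn dn] := hu n; have [Mm dm] := hu m.
  rewrite -(ltr_pXn2r (n := 2)) ?nnegrE ?nrm_ge0 ?(ltW e0) //.
  have := Ele _ (MZ ((2^-1)%:C)%C _ (ML 1 _ _ Mn Mm)); rewrite scale1r.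
  move: dn dm; rewrite -!rip_nrm !ripE (ripC (u n) p) (ripC (u m) p).
  rewrite (ripC (u m) (u n)) => dn dm; move: hn hm dn dm.
  by move: (n.+1%:R^-1) (m.+1%:R^-1) => s t; lra.
exists l; first by apply: Mclosed ul => n; case: (hu n).
apply: (rip0_ip0 MZ) => v Mv; set r := rip v _.
(* The point [u n + t *: v] of [M] is no nearer to [p] than the infimum; [e]
   absorbs both the defect of [u n] and its distance to [l]. *)
have key (t e : R) : 0 < e -> 2 * t * r <= e + t ^+ 2 * nrm v ^+ 2.
  move=> e0; have tv : 0 < 2 * `|t| * nrm v + 1.
    by rewrite ltr_wpDl ?mulr_ge0 ?nrm_ge0.
  have [|N1 h1] := @inv_small (e / 2); first lra.
  have [|N2 h2] := ul (e / 2 / (2 * `|t| * nrm v + 1)).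
    by rewrite divr_gt0 // divr_gt0.
  pose n := maxn N1 N2.
  have {}h1 := h1 n (leq_maxl _ _); have {}h2 := h2 n (leq_maxr _ _).
  have [Mn dn] := hu n.
  have /Ele := ML t%:C%C _ _ Mv Mn.
  have rE : r = rip v (p - u n) - rip v (l - u n) by rewrite /r !ripE; ring.
  have : - (2 * t * rip v (l - u n)) <= e / 2.
    have : `|2 * t * rip v (l - u n)| <= 2 * `|t| * nrm v * nrm (l - u n).
      rewrite !normrM normr_nat -!mulrA !ler_wpM2l //.
      rewrite ler_norml rip_le andbT lerNl -ripNl.
      by rewrite (le_trans (rip_le _ _)) // nrmN.
    move: h2; rewrite ltr_pdivlMr // => h2 h3.
    have : nrm (l - u n) * (2 * `|t| * nrm v) <= e / 2.
      by apply: le_trans (ltW h2); rewrite ler_wpM2l ?nrm_ge0 // lerDl.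
    by move: h3; rewrite ler_norml => /andP[]; lra.
  move: dn; rewrite rE -!rip_nrm !ripE (ripC p v) (ripC (u n) v).
  rewrite (ripC (u n) p); move: h1; move: (n.+1%:R^-1) => s; nra.
have V0 := sqr_ge0 (nrm v).
have {}key t : 2 * t * r <= t ^+ 2 * nrm v ^+ 2.
  by apply/ler_addgt0Pr => e /key; rewrite addrC; apply.
(* A small multiple of [r] makes the linear term dominate unless [r = 0]. *)
have := key (r / (nrm v ^+ 2 + 1)).
set V := nrm v ^+ 2 in V0 *.
have V1 : 0 < V + 1 by lra.
rewrite expr_div_n -subr_ge0.
rewrite (_ : _ - _ = - (r ^+ 2 * (V + 2)) / (V + 1) ^+ 2); last first.
  by field; rewrite gt_eqF.
rewrite ler_pdivlMr ?exprn_gt0 // mul0r oppr_ge0.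
have := sqr_ge0 r => r0 h; apply/eqP; rewrite -sqrf_eq0 eq_le r0 andbT.
nra.
Qed.

(** * Uniform boundedness and everywhere defined adjoints *)

(** Gliding hump.  If [S] contained elements [s n] with [nrm (s n)] above
    [6 * n * 3 ^ n], one would build [x] by adding at stage [n] a multiple
    of [s n] of length [3 ^- n.+1], with the sign that prevents cancellation in
    [rip x (s n)].  All later steps together have length at most half of that, so
    they cannot undo this contribution, and [rip l (s n)] is unbounded at the
    limit [l], against the weak bound there. *)
Lemma uniform_boundedness (S : set X) :
  (forall x, exists M, forall s, S s -> rip x s <= M) ->
  exists M, forall s, S s -> nrm s <= M.
Proof.
move=> Sw; apply: contrapT => unb.
have p3 n : 0 < 3 ^- n :> R by rewrite invr_gt0 exprn_gt0.
have p3S n : 3 ^- n = 3 * 3 ^- n.+1 :> R.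
  by rewrite exprS invfM mulrA divff ?mul1r.
have /choice[s hs] : forall n : nat, exists s, S s /\
    n%:R < 3 ^- n.+1 / 2 * nrm s.
  move=> n; apply: contrapT => hn; apply: unb.
  exists (n%:R / (3 ^- n.+1 / 2)) => s Ss; rewrite leNgt; apply/negP => h.
  apply: hn; exists s; split=> //.
  by move: h; rewrite ltr_pdivrMr ?divr_gt0 // mulrC.
pose sg n x : R := if 0 <= rip x (s n) then 1 else -1.
pose x := fix x n := if n is n'.+1 then
  x n' + (sg n' (x n') * 3 ^- n / nrm (s n'))%:C%C *: s n' else 0.
have sp n : 0 < nrm (s n).
  have [_ h] := hs n; rewrite lt_def nrm_ge0 andbT; apply/eqP => s0.
  by move: h; rewrite s0 mulr0 ltNge ler0n.
have step n : nrm (x n.+1 - x n) <= 3 ^- n.+1.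
  rewrite /= addrC addKr nrmZ !normrM (gtr0_norm (p3 _)) normfV.
  rewrite (gtr0_norm (sp n)) divfK ?gt_eqF // -[leRHS]mul1r.
  rewrite ler_wpM2r ?(ltW (p3 _)) //.
  by rewrite /sg; case: ifP; rewrite ?normrN normr1.
have big n : 3 ^- n.+1 * nrm (s n) <= `|rip (x n.+1) (s n)|.
  have := mulr_gt0 (p3 n.+1) (sp n); set a := 3 ^- _ * nrm _ => a0.
  have -> : rip (x n.+1) (s n) = rip (x n) (s n) + sg n (x n) * a.
    rewrite /= ripDl ripZl rip_nrm /a; field.
    by rewrite expf_neq0 /=; [rewrite gt_eqF //; exact: sp | rewrite pnatr_eq0].
  rewrite /sg; case: ifP => [h|/negbT].
    by rewrite mul1r (le_trans _ (ler_norm _)) // lerDr.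
  rewrite -ltNge => h; rewrite mulN1r ltr0_norm; first lra.
  lra.
have dist n k : nrm (x (n + k)%N - x n) <= (3 ^- n - 3 ^- (n + k)) / 2.
  elim: k => [|k IH].
    by rewrite addn0 !subrr mul0r /nrm normr0.
  rewrite addnS -(subrK (x (n + k)%N) (x _)) -addrA.
  apply: le_trans (nrmD _ _) _; have := step (n + k)%N.
  by move: IH; rewrite (p3S (n + k)%N); lra.
have distle n m : (n <= m)%N -> nrm (x m - x n) <= 3 ^- n / 2.
  move=> nm; have := dist n (m - n)%N; rewrite subnKC // => h.
  by have := p3 m; lra.
have small (e : R) : 0 < e -> exists N : nat, 3 ^- N < e.
  move=> e0; have [N hN] := @inv_small _ e0; exists N.
  apply: le_lt_trans (hN N (leqnn N)); rewrite lef_pV2 ?posrE ?exprn_gt0 //.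
  by rewrite -natrX ler_nat; apply: ltn_expl.
have [l xl] : exists l, tends x l.
  apply: cauchy_tends => e /small[N hN]; exists N => n m Nn Nm.
  rewrite -(subrK (x N) (x n)) -addrA (le_lt_trans (nrmD _ _)) //.
  have := distle _ _ Nn; have := distle _ _ Nm.
  by rewrite -nrmN opprB; lra.
have dl n : nrm (l - x n) <= 3 ^- n / 2.
  apply/ler_addgt0Pr => e /xl[N hN].
  have h1 := hN _ (leq_maxl N n); have h2 := distle _ _ (leq_maxr N n).
  rewrite -(subrK (x (maxn N n)) l) -addrA (le_trans (nrmD _ _)) //.
  lra.
have grow n : n%:R <= `|rip l (s n)|.
  have [_ h] := hs n.
  have h1 : `|rip (l - x n.+1) (s n)| <= 3 ^- n.+1 / 2 * nrm (s n).
    have h2 : nrm (l - x n.+1) * nrm (s n) <= 3 ^- n.+1 / 2 * nrm (s n).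
      by rewrite ler_wpM2r ?nrm_ge0.
    rewrite ler_norml (le_trans (rip_le _ _) h2) andbT lerNl -ripNl.
    by rewrite (le_trans (rip_le _ _)) // nrmN.
  have h2 := big n.
  have : `|rip (x n.+1) (s n)| <= `|rip l (s n)| + `|rip (l - x n.+1) (s n)|.
    have -> : rip (x n.+1) (s n) = rip l (s n) - rip (l - x n.+1) (s n).
      by move: (x n.+1) => z; rewrite ripDl ripNl opprB addrC subrK.
    exact: ler_normB.
  move: h h1 h2; move: (3 ^- n.+1) => a; lra.
have [M1 h1] := Sw l; have [M2 h2] := Sw (- l).
pose n := (Num.truncn (Num.max M1 M2)).+1.
have [Sn _] := hs n.
have : `|rip l (s n)| <= Num.max M1 M2.
  rewrite ler_norml le_max h1 // andbT lerNl le_max.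
  by rewrite -ripNl h2 // orbT.
by apply/negP; rewrite -ltNge (lt_le_trans _ (grow n)) // truncnS_gt.
Qed.

Lemma tends_ip (v k : nat -> X) y l a b :
  tends v y -> tends k l -> (forall n, ip a (v n) = ip b (k n)) ->
  ip a y = ip b l.
Proof.
have le a' b' v' y' k' l' : tends v' y' -> tends k' l' ->
    (forall n, rip a' (v' n) = rip b' (k' n)) -> rip a' y' <= rip b' l'.
  move=> vy kl vk; apply/ler_addgt0Pr => e e0.
  have c0 : 0 < 2 * (nrm a' + nrm b' + 1).
    by have := nrm_ge0 a'; have := nrm_ge0 b'; lra.
  have [|N1 h1] := vy (e / (2 * (nrm a' + nrm b' + 1))).
    by rewrite divr_gt0.
  have [|N2 h2] := kl (e / (2 * (nrm a' + nrm b' + 1))).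
    by rewrite divr_gt0.
  have {}h1 := h1 _ (leq_maxl N1 N2); have {}h2 := h2 _ (leq_maxr N1 N2).
  move: h1 h2; rewrite !ltr_pdivlMr //.
  have := vk (maxn N1 N2).
  have := rip_le a' (y' - v' (maxn N1 N2)).
  have := rip_le (- b') (l' - k' (maxn N1 N2)).
  rewrite nrmN !ripE; move: (nrm_ge0 a') (nrm_ge0 b').
  move: (nrm_ge0 (l' - k' (maxn N1 N2))) (nrm_ge0 (y' - v' (maxn N1 N2))).
  by nra.
move=> vy kl vk.
have eq c : rip (c *: a) y = rip (c *: b) l.
  have ck n : rip (c *: a) (v n) = rip (c *: b) (k n) by rewrite /rip !ipZl vk.
  by apply/eqP; rewrite eq_le (le _ _ _ _ _ _ vy kl) // (le _ _ _ _ _ _ kl vy).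
have := eq 1; have := eq 'i%C; rewrite /rip !ipZl !mul1r.
case: (ip a y) (ip b l) => [r1 i1] [r2 i2] /=.
by rewrite !mul0r !mul1r !sub0r => /oppr_inj -> ->.
Qed.

(** A Hellinger-Toeplitz argument.  Let [D] be the domain of the adjoint of [F].
    The values [k] of the adjoint on the unit ball of [D] are weakly bounded,
    because [ip w k = ip (F w) v] is at most [nrm (F w)] for every [w].  By uniform
    boundedness the adjoint is bounded on [D], and it extends by continuity to
    the closure of [D].  Linearity of [F] is a consequence of the density of
    [D]. *)
Lemma adjoint_total (F : X -> X) :
  dense [set v | exists k, forall w, ip (F w) v = ip w k] ->
  forall y, exists k, forall w, ip (F w) y = ip w k.
Proof.
set D := [set v | _] => Dd.
have [M hM] : exists M, forall k,
    [set k | exists2 v, nrm v <= 1 & forall w, ip (F w) v = ip w k] k ->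
    nrm k <= M.
  apply: uniform_boundedness => w; exists (nrm (F w)) => k [v v1 vk].
  rewrite /rip -vk -/(rip _ _) (le_trans (rip_le _ _)) //.
  by rewrite -[leRHS]mulr1 ler_wpM2l ?nrm_ge0.
pose M' := Num.max M 1.
have M'0 : 0 < M' by rewrite lt_max ltr01 orbT.
have bnd v k : (forall w, ip (F w) v = ip w k) -> nrm k <= M' * nrm v.
  move=> vk; have [v0|v0] := eqVneq (nrm v) 0.
    suff -> : k = 0 by rewrite /nrm normr0 mulr_ge0 // ?nrm_ge0 // ltW.
    by apply: ip_inj => w; rewrite -vk (nrm0_eq0 v0) !ip0r.
  have vp : 0 < nrm v by rewrite lt_def v0 nrm_ge0.
  rewrite -ler_pdivrMr // mulrC.
  have <- : nrm ((nrm v)^-1%:C%C *: k) = (nrm v)^-1 * nrm k.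
    by rewrite nrmZ gtr0_norm // invr_gt0.
  rewrite le_max hM //; exists ((nrm v)^-1%:C%C *: v).
    by rewrite nrmZ gtr0_norm ?invr_gt0 // mulVf.
  by move=> w; rewrite !ipZr vk.
move=> y; have [v Dv vl] := dense_tends Dd y.
have /choice[k hk] : forall n, exists k, forall w, ip (F w) (v n) = ip w k.
  by move=> n; have [k ?] := Dv n; exists k.
have [l kl] : exists l, tends k l.
  apply: cauchy_tends => e e0.
  have [|N hN] := vl (e / M' / 2); first by rewrite !divr_gt0.
  exists N => n m /hN hn /hN hm.
  apply: (@le_lt_trans _ _ (M' * nrm (v n - v m))).
    by apply: bnd => w; rewrite !ipDr !ipNr !hk.
  rewrite mulrC -ltr_pdivlMr // -(subrK y (v n)) -addrA.
  apply: le_lt_trans (nrmD _ _) _; rewrite -[nrm (v n - y)]nrmN opprB.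
  lra.
exists l.
by move=> w; apply: tends_ip vl kl _ => n; apply: hk.
Qed.

(** * Resolvents of self-adjoint operators *)

Lemma op_resolventE (B : set (X * X)) (lambda : R[i]) w u :
  ((B - lambda%:I)^-1)%op (w, u) <-> B (u, w + lambda *: u).
Proof.
split=> [[y [z [/= Buy /= zE ->]]]|Bu].
  by rewrite -zE addrK.
exists (w + lambda *: u), (- (lambda *: u)); split=> //=.
  by rewrite /op_opp /op_scalar /= opprK.
by rewrite addrK.
Qed.

(** The bounded inverse as a function [G] that is characterised by its graph. *)
Lemma resolvent_setP (B : set (X * X)) (lambda : R[i]) :
  resolvent_set B lambda <->
  exists G : {linear X -> X},
    (exists M : R, forall w, nrm (G w) <= M * nrm w) /\
    (forall w u, B (u, w + lambda *: u) <-> u = G w).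
Proof.
split=> [[G Gc GE]|[G [[M GM] GE]]].
  exists G; split.
    have /linear_boundedP : bounded_near G (nbhs (0 : X)).
      exact/linear_bounded_continuous.
    case=> M [Mr /(_ (M + 1))]; rewrite ltrDl ltr01 => /(_ isT) h.
    exists (complex.Re M + 1) => w; rewrite -lecR rmorphM rmorphD /= -!nrmE.
    by rewrite RRe_real.
  by move=> w u; rewrite -op_resolventE GE.
exists G.
  apply/linear_bounded_continuous/linear_boundedP.
  exists `|M|%:C%C; split; first by rewrite complex_real.
  move=> r; rewrite ltcE => /andP[/eqP ri Mr] w.
  have -> : r = (complex.Re r)%:C%C.
    by move: ri; case: (r) => a b /= ->.
  rewrite !nrmE -rmorphM lecR (le_trans (GM w)) // ler_wpM2r ?nrm_ge0 //.
  by rewrite (le_trans (ler_norm _)) // ltW.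
by apply/seteqP; split=> -[w u] /=; rewrite op_resolventE GE.
Qed.

Section SelfAdjoint.
Variable B : set (X * X).
Hypotheses (B_op : is_operator B) (B_sa : B = adjoint ip B).

Lemma sa_sym x y u v : B (x, y) -> B (u, v) -> ip y u = ip x v.
Proof. by move=> Bx; rewrite {1}B_sa; apply. Qed.

(** The lower bound makes [B - mu] injective with closed range.  A vector
    orthogonal to the range lies in the kernel of [B - mu^*], because [B] equals
    its adjoint.  That kernel is zero, so the range is everything. *)
Lemma mem_resolvent (c : R) (mu : R[i]) : 0 < c ->
  (forall x y, B (x, y) -> c * nrm x <= nrm (y - mu *: x)) ->
  (forall x, B (x, mu^* *: x) -> x = 0) ->
  resolvent_set B mu.
Proof.
move=> c0 Bc ker0; have [B0 BL B1] := B_op.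
pose M := [set z | exists x, B (x, z + mu *: x)].
have ML a u v : M u -> M v -> M (a *: u + v).
  move=> [x Bx] [x' Bx']; exists (a *: x + x').
  have := BL a _ _ Bx Bx'; congr (B (_, _)) => /=.
  by rewrite !scalerDr !scalerA (mulrC a) addrACA.
have Mclosed u l : (forall n, M (u n)) -> tends u l -> M l.
  move=> /choice[x Bx] ul.
  have xc n m : c * nrm (x n - x m) <= nrm (u n - u m).
    have := BL (-1) _ _ (Bx m) (Bx n).
    rewrite scaleN1r addrC => /Bc /=.
    by rewrite scalerBr (opprD (u m)) addrACA addrK.
  have [y xy] : exists y, tends x y.
    apply: cauchy_tends => e e0.
    have [|N hN] := ul (c * e / 2); first by rewrite divr_gt0 ?mulr_gt0.
    exists N => n m /hN hn /hN hm; rewrite -(ltr_pM2l c0).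
    apply: le_lt_trans (xc _ _) _; rewrite -(subrK l (u n)) -addrA.
    apply: le_lt_trans (nrmD _ _) _; rewrite -[nrm (u n - l)]nrmN opprB.
    lra.
  exists y; rewrite B_sa => p q Bpq /=.
  have h : ip (q - mu^* *: p) y = ip p l.
    apply: tends_ip xy ul _ => n; rewrite ipDl ipNl ipZl (sa_sym Bpq (Bx n)).
    by rewrite ipDr ipZr addrK.
  by rewrite ipDr ipZr -h ipDl ipNl ipZl subrK.
have Mtot p : M p.
  have M0 : M 0 by exists 0; rewrite scaler0 addr0.
  have [m Mm mp] := projection p M0 ML Mclosed.
  suff /subr0_eq -> : p - m = 0 by [].
  apply: ker0; rewrite B_sa => x y Bx /=.
  have /mp : M (y - mu *: x) by exists x; rewrite subrK.
  by rewrite ipDl ipNl ipZl ipZr conjCK => /subr0_eq.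
have /choice[G BG] := Mtot.
have Guniq w u : B (u, w + mu *: u) -> u = G w.
  move=> Bu; have := BL (-1) _ _ Bu (BG w); rewrite scaleN1r => /Bc /=.
  rewrite opprD addrACA addNr add0r scalerDr scalerN subrr.
  rewrite {2}/nrm normr0 pmulr_rle0 // => h.
  apply/esym/eqP; rewrite -subr_eq0 addrC; apply/eqP/nrm0_eq0/eqP.
  by rewrite eq_le h nrm_ge0.
have Glin : linear G.
  move=> a u v; apply/esym/Guniq.
  have := BL a _ _ (BG u) (BG v); congr (B (_, _)) => /=.
  by rewrite !scalerDr !scalerA (mulrC a) addrACA.
pose GL : {linear X -> X} := HB.pack G (GRing.isLinear.Build _ _ _ _ G Glin).
apply/resolvent_setP; exists GL; split.
  exists c^-1 => w; rewrite mulrC ler_pdivlMr // mulrC.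
  by have := Bc _ _ (BG w); rewrite addrK.
by move=> w u; split=> [|->]; [exact: Guniq | exact: BG].
Qed.

(** For [B x = y], moving the resolvent [G] across the inner product gives
    [|x|^2 = ip (G x) (y - lambda^* *: x)], hence the lower bound required for
    [lambda^*]. *)
Lemma resolvent_conj (lambda : R[i]) :
  resolvent_set B lambda -> resolvent_set B lambda^*.
Proof.
move=> /resolvent_setP[G [[M GM] GE]].
have M1 : 0 < `|M| + 1 by rewrite ltr_wpDl.
apply: (@mem_resolvent (`|M| + 1)^-1); first by rewrite invr_gt0.
  move=> x y Bx; rewrite mulrC ler_pdivrMr // mulrC.
  have [->|x0] := eqVneq (nrm x) 0.
    by rewrite mulr_ge0 ?nrm_ge0 // ltW.
  have xp : 0 < nrm x by rewrite lt_def x0 nrm_ge0.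
  rewrite -(ler_pM2l xp) -expr2 -rip_nrm.
  have BG : B (G x, x + lambda *: G x) by apply/GE.
  have -> : rip x x = rip (G x) (y - lambda^* *: x).
    rewrite /rip ipDr ipNr ipZr conjCK -(sa_sym BG Bx) ipDl ipZl.
    by rewrite addrK.
  apply: le_trans (rip_le _ _) _; rewrite mulrA ler_wpM2r ?nrm_ge0 //.
  rewrite mulrC (le_trans (GM x)) // ler_wpM2r ?nrm_ge0 //.
  by rewrite (le_trans (ler_norm _)) // lerDl.
move=> x; rewrite conjCK => Bx.
by rewrite -(linear0 G); apply/GE; rewrite add0r.
Qed.

(** As [ip y x] is real when [B x = y], the mixed terms cancel in
    [|y - mu *: x|^2 = |y|^2 + |x|^2] for [mu] equal to ['i] or to [- 'i]. *)
Lemma resolvent_i : resolvent_set B 'i%C.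
Proof.
have Bc (mu : R[i]) x y : mu^* = - mu -> `|mu| = 1 -> B (x, y) ->
    nrm x <= nrm (y - mu *: x).
  move=> muJ mu1 Bx.
  rewrite -(ler_pXn2r (n := 2)) ?nnegrE ?nrm_ge0 // -!rip_nrm.
  rewrite !ripE (ripC (mu *: x)).
  have -> : rip y (mu *: x) = 0.
    have yx : (ip y x)^* = ip y x by rewrite -ipC (sa_sym Bx Bx).
    suff : rip y (mu *: x) + rip y (mu *: x) = 0 by lra.
    rewrite /rip -{2}ReJ -ReD ipZr rmorphM /= conjCK yx muJ.
    by rewrite mulNr addNr.
  have -> : rip (mu *: x) (mu *: x) = rip x x.
    by rewrite /rip dnormZ mu1 expr1n mul1r.
  by rewrite oppr0 addr0 sub0r opprK lerDr rip_nrm sqr_ge0.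
have i1 : `|'i%C| = 1 :> R[i].
  by rewrite normc_def /= expr0n expr1n add0r sqrtr1.
have iJ : ('i%C)^* = - 'i%C :> R[i].
  by apply/eqP; rewrite eq_complex /= oppr0 !eqxx.
apply: (@mem_resolvent 1) => // [x y /Bc h|x]; first by rewrite mul1r h.
rewrite iJ => /Bc h; apply/nrm0_eq0/eqP; rewrite eq_le nrm_ge0 andbT.
have NiJ : (- 'i%C)^* = - - 'i%C :> R[i] by rewrite -iJ conjCK iJ opprK.
have := h _ NiJ; rewrite normrN => /(_ i1).
by rewrite subrr [X in _ <= X]/nrm normr0.
Qed.

End SelfAdjoint.

(** * The Schur complement *)

Lemma op_N (T : set (X * X)) x y : is_operator T -> T (x, y) -> T (- x, - y).
Proof.
move=> [T0 TL _] Txy; have := TL (-1) _ _ Txy T0.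
by rewrite addr0 scaleN1r.
Qed.

Lemma op_D (T : set (X * X)) x y u v : is_operator T ->
  T (x, y) -> T (u, v) -> T (x + u, y + v).
Proof. by move=> [_ TL _] Txy /(TL 1 _ _ Txy); rewrite scale1r. Qed.

(** For [A'] the adjoint of [A], this is the product [J H] of the Hamiltonian
    matrix; keeping [A'] free makes the pair [A, A'] symmetric. *)
Definition saddle (A A' B C : set (X * X)) : set ((X * X) * (X * X)) :=
  block_op C (- A')%op (- A)%op (- B)%op.

(** Schur complement of the second diagonal entry of [saddle + lambda]. *)
Definition schur (A A' B C : set (X * X)) (lambda : R[i]) : set (X * X) :=
  (C + lambda%:I + (A' \; (B - lambda%:I)^-1 \; A))%op.

Lemma saddleE A A' B C x1 x2 z1 z2 :
  saddle A A' B C ((x1, x2), (z1, z2)) <->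
  exists c a' a b, [/\ C (x1, c), A' (x2, a'), A (x1, a), B (x2, b)
    & z1 = c - a' /\ z2 = - a - b].
Proof.
split=> [[c [a' [a [b [[/= Cc A'a] [/= Aa Bb] [-> ->]]]]]]|].
  by exists c, (- a'), (- a), (- b); rewrite !opprK.
move=> [c [a' [a [b [Cc A'a Aa Bb [-> ->]]]]]].
exists c, (- a'), (- a), (- b); split=> //; split=> //=;
  by rewrite /op_opp /= opprK.
Qed.

Lemma schurE A A' B C lambda (G : X -> X) y z :
  (forall w u, B (u, w + lambda *: u) <-> u = G w) ->
  schur A A' B C lambda (y, z) <->
  exists c a h, [/\ C (y, c), A (y, a), A' (G a, h)
    & z = c + lambda *: y + h].
Proof.
move=> GE; split.
  rewrite /schur /op_add /op_scalar /op_comp /=.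
  move=> [_ [h [[c [_ [Cc -> ->]]] [g [a Aa /op_resolventE/GE -> A'h]] ->]]].
  by exists c, a, h.
move=> [c [a [h [Cc Aa A'h ->]]]]; exists (c + lambda *: y), h; split=> //=.
  by exists c, (lambda *: y).
by exists (G a) => //; exists a => //=; apply/op_resolventE/GE.
Qed.

Section Schur.
Variables A A' B C : set (X * X).
Hypotheses (A_op : is_operator A) (A'_op : is_operator A').
Hypothesis AA' : forall x a y a', A (x, a) -> A' (y, a') -> ip a y = ip x a'.
Hypotheses (B_op : is_operator B) (B_sa : B = adjoint ip B).
Hypotheses (C_op : is_operator C) (C_sa : C = adjoint ip C).
Hypotheses (domBA' : dom B `<=` dom A').
Hypothesis A_dense : dense (dom A).

Lemma A'A y a' x a : A' (y, a') -> A (x, a) -> ip a' x = ip y a.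
Proof. by move=> A'y Ax; rewrite ipC -(AA' Ax A'y) -ipC. Qed.

Lemma saddle_symmetric :
  saddle A A' B C `<=` adjoint (ip_prod ip) (saddle A A' B C).
Proof.
move=> [[y1 y2] [z1 z2]] /saddleE[c [a' [a [b [Cc A'a Aa Bb [-> ->]]]]]].
move=> [x1 x2] [t1 t2] /saddleE[d [e' [e [f [Cd A'e Ae Bf [-> ->]]]]]].
rewrite /ip_prod /= !ipE (sa_sym C_sa Cd Cc) (A'A A'e Aa) (AA' Ae A'a).
by rewrite (sa_sym B_sa Bf Bb); ring.
Qed.

Section Resolvent.
Variables (lambda : R[i]) (G Gb : X -> X).
Hypothesis GE : forall w u, B (u, w + lambda *: u) <-> u = G w.
Hypothesis GbE : forall w u, B (u, w + lambda^* *: u) <-> u = Gb w.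

Lemma resolvent_adj w y : ip (Gb w) y = ip w (G y).
Proof.
have BG : B (G y, y + lambda *: G y) by apply/GE.
have BGb : B (Gb w, w + lambda^* *: Gb w) by apply/GbE.
by have := sa_sym B_sa BGb BG; rewrite !ipE => /addIr.
Qed.

Lemma resolventD a z : G (a + z) = G a + G z.
Proof.
apply/esym/GE; rewrite scalerDr addrACA.
by apply: op_D => //; apply/GE.
Qed.

Lemma schur_symmetric :
  schur A A' B C lambda `<=` adjoint ip (schur A A' B C lambda^*).
Proof.
move=> [y z] /(schurE _ _ _ _ _ GE)[c [a [h [Cc Aa A'h ->]]]] x t.
move=> /(schurE _ _ _ _ _ GbE)[d [e [g [Cd Ae A'g ->]]]] /=.
rewrite !ipE (sa_sym C_sa Cd Cc) (A'A A'g Aa) resolvent_adj.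
by rewrite (AA' Ae A'h).
Qed.

(** The bounded resolvent [Gb] takes its values in the domain of [B], hence in
    that of [A']. *)
Lemma total_A'Gb : exists F : X -> X, forall w, A' (Gb w, F w).
Proof.
have /choice[F A'F] : forall w, exists f, A' (Gb w, f).
  by move=> w; apply: domBA'; exists (w + lambda^* *: Gb w); apply/GbE.
by exists F.
Qed.

(** [F] is the operator [A' Gb]; on the dense domain of [A] its adjoint is given
    by the explicit formula [G A]. *)
Lemma total_adjoint F : (forall w, A' (Gb w, F w)) ->
  forall y, exists k, forall w, ip (F w) y = ip w k.
Proof.
move=> A'F; apply: adjoint_total => O O0 Oo.
have [v [Ov [a Aa]]] := A_dense O0 Oo.
exists v; split=> //; exists (G a) => w.
by rewrite (A'A (A'F w) Aa) resolvent_adj.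
Qed.

(** Suppose that [(y, z)] is in the graph of the adjoint of the Schur complement.
    The second component that cancels the second row of [saddle + lambda] would be
    [- G (A y)], but [y] is not yet known to be in the domain of [A].  The adjoint
    value [k] of [A' Gb] at [y] replaces [G (A y)]: the pair [(y, - k)] lies in the
    domain of the adjoint of the saddle operator, hence in the domain of that
    operator, and reading off its two rows gives the claim. *)
Lemma saddle_to_schur :
  saddle A A' B C = adjoint (ip_prod ip) (saddle A A' B C) ->
  adjoint ip (schur A A' B C lambda^*) `<=` schur A A' B C lambda.
Proof.
move=> T_sa [y z] Sz; have [F A'F] := total_A'Gb.
have [k Fk] := total_adjoint A'F y.
have : saddle A A' B C ((y, - k), (z - lambda *: y, lambda *: k)).
  rewrite T_sa => -[x1 x2] [t1 t2] /saddleE.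
  move=> [c [a' [a [b [Cc A'a Aa Bb [-> ->]]]]]].
  have x2E : x2 = Gb (b - lambda^* *: x2) by apply/GbE; rewrite subrK.
  have a'E : a' = F (b - lambda^* *: x2).
    case: A'_op => _ _ A'1; apply: (A'1 x2) => //.
    by rewrite {1}x2E.
  have : schur A A' B C lambda^* (x1, c + lambda^* *: x1 + F a).
    by apply/(schurE _ _ _ _ _ GbE); exists c, a, (F a).
  move=> /Sz; rewrite /ip_prod /= !ipE a'E !Fk !ipE => h.
  by rewrite -h; ring.
move=> /saddleE[c [a' [a [b [Cc A'a Aa Bb [zE kE]]]]]].
have kG : k = G a.
  apply/GE; have := op_N B_op Bb; rewrite opprK; congr (B (_, _)).
  by rewrite kE addrA addrN add0r.
apply/(schurE _ _ _ _ _ GE); exists c, a, (- a'); split=> //.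
  by rewrite -kG -(opprK k); apply: op_N.
by rewrite -(subrK (lambda *: y) z) zE addrAC.
Qed.

(** Testing an element [((y1, y2), (t1, t2))] of the adjoint graph on vectors
    [(0, Gb w)] identifies [- (y2 + G z2)] as the adjoint value of [A' Gb] at [y1].
    Testing on the vectors [(x1, - Gb (A x1))], which eliminate the second row of
    [saddle + lambda^*], shows that [y1] is in the domain of the adjoint of the
    Schur complement, hence in that of [C] and of [A]; then the adjoint value is
    [G (A y1)], which places [y2] in the domain of [B]. *)
Lemma schur_to_saddle :
  adjoint ip (schur A A' B C lambda^*) `<=` schur A A' B C lambda ->
  adjoint (ip_prod ip) (saddle A A' B C) `<=` saddle A A' B C.
Proof.
move=> S_sa [[y1 y2] [t1 t2]] Ty; have [F A'F] := total_A'Gb.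
pose z1 := t1 + lambda *: y1; pose z2 := t2 + lambda *: y2.
have B_Gb w : B (Gb w, w + lambda^* *: Gb w) by apply/GbE.
have B_G w : B (G w, w + lambda *: G w) by apply/GE.
have Fk w : ip (F w) y1 = ip w (- (y2 + G z2)).
  have : saddle A A' B C
      ((0, Gb w), (0 - F w, - 0 - (w + lambda^* *: Gb w))).
    apply/saddleE; exists 0, (F w), 0, (w + lambda^* *: Gb w).
    by split=> //; [case: C_op | case: A_op].
  move=> /Ty; rewrite /ip_prod /= !ipE -resolvent_adj /z2 !ipE => h.
  move: h; move: (ip (F w) y1) (ip w y2) (ip (Gb w) y2) (ip (Gb w) t2).
  move=> p q r s h; have {h} : s = - p - q - lambda^* * r.
    by rewrite -[s]add0r -h; ring.
  by move=> ->; ring.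
have [h0 A'h0] : dom A' (G z2) by apply: domBA'; exists (z2 + lambda *: G z2).
have : schur A A' B C lambda (y1, z1 - h0).
  apply: S_sa => x1 t /(schurE _ _ _ _ _ GbE)[c [a [h [Cc Aa A'h ->]]]].
  have : saddle A A' B C ((x1, - Gb a),
      (c - - h, - a - - (a + lambda^* *: Gb a))).
    apply/saddleE; exists c, (- h), a, (- (a + lambda^* *: Gb a)).
    by split=> //; apply: op_N.
  move=> /Ty; rewrite /ip_prod /= /z1 !ipE.
  rewrite -(AA' Aa A'h0) -resolvent_adj /z2 !ipE.
  move: (ip (Gb a) t2) (ip x1 t1) => p q e.
  have -> : q = p + (ip c y1 + - - ip h y1 +
    (- ip a y2 + - - (ip a y2 + lambda^* * ip (Gb a) y2))) by rewrite e; ring.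
  by ring.
move=> /(schurE _ _ _ _ _ GE)[c [a [h [Cc Aa A'h z1E]]]].
have GaE : G a = - (y2 + G z2).
  by apply: ip_inj => w; rewrite -Fk (A'A (A'F w) Aa) resolvent_adj.
have y2E : y2 = - G (a + z2).
  by rewrite resolventD GaE opprD opprK addrK.
apply/saddleE; exists c, (- (h + h0)), a, (- (a + z2 + lambda *: G (a + z2))).
split=> //.
- rewrite y2E; apply: op_N => //; rewrite resolventD.
  exact: op_D.
- rewrite y2E; apply: op_N => //; exact: B_G.
split.
  apply: (addIr (lambda *: y1)); rewrite -/z1 -(subrK h0 z1) z1E opprK.
  by rewrite -!addrA; congr (_ + _); rewrite addrC -addrA.
rewrite opprK addrA (addrA (- a)) addNr add0r -{1}(addrK (lambda *: y2) t2).
by rewrite -/z2 y2E scalerN opprK.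
Qed.

End Resolvent.

Lemma saddle_schur lambda : resolvent_set B lambda ->
  saddle A A' B C = adjoint (ip_prod ip) (saddle A A' B C) <->
  schur A A' B C lambda = adjoint ip (schur A A' B C lambda^*).
Proof.
move=> lB; have /resolvent_setP[Gb [_ GbE]] := resolvent_conj B_op B_sa lB.
move: lB => /resolvent_setP[G [_ GE]]; split=> [T_sa|S_sa].
  apply/seteqP; split; first exact: schur_symmetric GE GbE.
  exact: saddle_to_schur GE GbE T_sa.
apply/seteqP; split; first exact: saddle_symmetric.
by apply: schur_to_saddle GE GbE _; rewrite -S_sa.
Qed.

(** The number ['i] shows that the resolvent set is not empty, so that the
    universal form of the condition implies the existential one. *)
Lemma saddle_schurP :
  (saddle A A' B C = adjoint (ip_prod ip) (saddle A A' B C) <->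
   exists2 lambda, resolvent_set B lambda &
     schur A A' B C lambda = adjoint ip (schur A A' B C lambda^*)) /\
  (saddle A A' B C = adjoint (ip_prod ip) (saddle A A' B C) <->
   forall lambda, resolvent_set B lambda ->
     schur A A' B C lambda = adjoint ip (schur A A' B C lambda^*)).
Proof.
have Bi := resolvent_i B_op B_sa.
split; split.
- by move=> T_sa; exists 'i%C => //; apply/saddle_schur.
- by move=> [lambda lB S_sa]; apply/(saddle_schur lB).
- by move=> T_sa lambda lB; apply/saddle_schur.
- by move=> S_sa; apply/(saddle_schur Bi); exact: S_sa.
Qed.

End Schur.

(** * Exchanging the roles of B and C *)

(** Exchanging the roles turns the saddle operator [T] into [- J^-1 T J]. *)
Lemma saddle_swap (A A' B C : set (X * X)) p1 p2 q1 q2 :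
  is_operator A -> is_operator C ->
  saddle A' A C B ((p1, p2), (q1, q2)) <->
  saddle A A' B C ((- p2, p1), (q2, - q1)).
Proof.
move=> A_op C_op; rewrite !saddleE; split.
  move=> [b [a [a' [c [Bb Aa A'a Cc [-> ->]]]]]].
  exists (- c), a', (- a), b; split=> //; [exact: op_N|exact: op_N|].
  by rewrite opprB addrC opprK.
move=> [c [a' [a [b [Cc A'a Aa Bb [-> qE]]]]]].
exists b, (- a), a', (- c); split=> //.
- by rewrite -(opprK p2); apply: op_N.
- by rewrite -(opprK p2); apply: op_N.
by rewrite -(opprK q1) qE !opprK opprD !opprK !(addrC c) [_ + a]addrC.
Qed.

Lemma saddle_swap_sa (A A' B C : set (X * X)) :
  is_operator A -> is_operator A' -> is_operator B -> is_operator C ->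
  saddle A A' B C = adjoint (ip_prod ip) (saddle A A' B C) ->
  saddle A' A C B = adjoint (ip_prod ip) (saddle A' A C B).
Proof.
move=> A_op A'_op B_op C_op T_sa; apply/seteqP.
split=> -[[p1 p2] [q1 q2]].
  rewrite saddle_swap // T_sa => Tp [x1 x2] [t1 t2].
  rewrite saddle_swap // => /Tp; rewrite /ip_prod /= !ipE.
  by rewrite -!opprD => /oppr_inj; rewrite addrC => ->; rewrite addrC.
move=> Tp; rewrite saddle_swap // T_sa => -[x1 x2] [t1 t2] Tx.
have : saddle A' A C B ((x2, - x1), (- t2, t1)).
  by rewrite saddle_swap // !opprK.
move=> /Tp; rewrite /ip_prod /= !ipE => h; apply: oppr_inj.
by rewrite !opprD !opprK addrC h addrC.
Qed.

(** * The Hamiltonian matrix *)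

Lemma Jop_block (A B C D : set (X * X)) :
  (Jop \; block_op A B C D)%op = block_op C D (- A)%op (- B)%op.
Proof.
apply/seteqP; split=> -[[x1 x2] z] /=.
  move=> [[u v] /= [a [b [c [d [[/= Aa Bb] [/= Cc Dd] [-> ->]]]]]] /JopE ->].
  exists c, d, (- a), (- b); rewrite opprD; split=> //; split=> //=.
    by rewrite /op_opp /= opprK.
  by rewrite /op_opp /= opprK.
move=> [c [d [a [b [[/= Cc Dd] [/= Aa Bb] ->]]]]].
exists (- a - b, c + d); last by apply/JopE; rewrite opprD !opprK.
by exists (- a), (- b), c, d.
Qed.

(** Density of the domain makes the adjoint single-valued. *)
Lemma adjoint_op (T : set (X * X)) :
  dense (dom T) -> is_operator (adjoint ip T).
Proof.
move=> Td; split=> [x y _|a [x y] [u v] Tx Tu p q Tpq|x y z Ty Tz].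
- by rewrite !ip0r.
- by rewrite /= !ipE (Tx _ _ Tpq) (Tu _ _ Tpq).
have TE p q : T (p, q) -> ip p (y - z) = 0.
  by move=> Tpq; rewrite !ipE -(Ty _ _ Tpq) -(Tz _ _ Tpq) subrr.
apply: subr0_eq.
have [v Tv vl] := dense_tends Td (y - z).
apply/eqP; rewrite -(dnorm_eq0 ip); apply/eqP.
have tends0 : tends (fun=> 0) 0.
  by move=> e e0; exists 0%N => n _; rewrite subrr /nrm normr0.
rewrite -(ip0r 0); apply: (tends_ip vl tends0) => n.
by have [q /TE h] := Tv n; rewrite ipC h !ip0r conjC0.
Qed.

End ComplexHilbert.

Theorem theorem3p2 (R : realType) (X : completeNormedModType R[i])
    (ip : {dot X for (@Num.conj R[i])}) (ip_hilbert : hilbert_ip ip)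
    (A B C : set (X * X)) (H : set ((X * X) * (X * X)))
    (H_def : H = hamiltonian_op ip A B C)
    (H_hamiltonian : is_hamiltonian ip A B C)
    (dom_H : dom H = dom C `*` dom B) :
  let SB (lambda : R[i]) :=
    (C + lambda%:I + (adjoint ip A \; (B - lambda%:I)^-1 \; A))%op in
  let SC (lambda : R[i]) :=
    (B + lambda%:I + (A \; (C - lambda%:I)^-1 \; adjoint ip A))%op in
  [/\ symplectic_selfadjoint ip H <->
        (exists2 lambda, resolvent_set B lambda &
           SB lambda = adjoint ip (SB lambda^*)),
      symplectic_selfadjoint ip H <->
        (forall lambda, resolvent_set B lambda ->
           SB lambda = adjoint ip (SB lambda^*)),
      symplectic_selfadjoint ip H <->
        (exists2 lambda, resolvent_set C lambda &
           SC lambda = adjoint ip (SC lambda^*))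
    & symplectic_selfadjoint ip H <->
        (forall lambda, resolvent_set C lambda ->
           SC lambda = adjoint ip (SC lambda^*))].
Proof.
move=> SB SC; subst H.
have [[A_op _ A_dense] [[B_op _ B_dense] B_sa] [[C_op _ C_dense] C_sa] _] :=
  H_hamiltonian.
have A'_op := adjoint_op ip_hilbert A_dense.
have [B0 _ _] := B_op; have [C0 _ _] := C_op.
have domCA : dom C `<=` dom A.
  move=> x Cx; have : (dom C `*` dom B) (x, 0) by split=> //; exists 0.
  by rewrite -dom_H /hamiltonian_op dom_block_op => -[[]].
have domBA' : dom B `<=` dom (adjoint ip A).
  move=> x Bx; have : (dom C `*` dom B) (0, x) by split=> //; exists 0.
  rewrite -dom_H /hamiltonian_op dom_block_op => -[_ [_ [y Ay]]].
  by exists (- y).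
have A'_dense : dense (dom (adjoint ip A)).
  move=> O O0 Oo; have [x [Ox Bx]] := B_dense O O0 Oo.
  by exists x; split=> //; apply: domBA'.
have AA' x a y a' : A (x, a) -> adjoint ip A (y, a') -> ip a y = ip x a'.
  by move=> Aa; apply.
have A'A y a' x a : adjoint ip A (y, a') -> A (x, a) -> ip a' x = ip y a.
  by move=> A'a Aa; rewrite ipC -(A'a _ _ Aa) -ipC.
have [B1 B2] := saddle_schurP ip_hilbert A_op A'_op AA' B_op B_sa C_op C_sa
  domBA' A_dense.
have [C1 C2] := saddle_schurP ip_hilbert A'_op A_op A'A C_op C_sa B_op B_sa
  domCA A'_dense.
have swap : saddle A (adjoint ip A) B C =
      adjoint (ip_prod ip) (saddle A (adjoint ip A) B C) <->
    saddle (adjoint ip A) A C B =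
      adjoint (ip_prod ip) (saddle (adjoint ip A) A C B).
  by split; apply: saddle_swap_sa.
rewrite /symplectic_selfadjoint /hamiltonian_op Jop_block -/(saddle _ _ _ _).
by split=> //; rewrite swap.
Qed.
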